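(* Let $G$ be a finite simple graph on $n$ vertices with adjacency matrix $A$. For $k=1$, the value $$\mu_1(G)=\min_{p\in\mathbb R_1[x]}\ \sum_{\substack{0\le j\le d\\ p(\theta_j)\ge 0}} m_j\quad\text{subject to}\quad (p(A))_{vv}\ge 0\ \text{for all } v\in V(G)$$ can be computed during the spectral preprocessing (computing the distinct eigenvalues of $A$ with their multiplicities) with no additional asymptotic cost; in particular, including the spectral preprocessing, $\mu_1(G)$ can be computed in $\mathcal O(n^3)$ time.
   Context: $\theta_0>\cdots>\theta_d$ are the distinct adjacency eigenvalues of $G$ with multiplicities $m_0,\ldots,m_d$. $\mathbb R_1[x]$ is the set of real polynomials of degree at most $1$, and $p(A)=a_0I+a_1A$ for $p(x)=a_0+a_1x$. *)

(* Defs.v *)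
From HB Require Import structures.
From mathcomp Require Import all_boot all_order all_algebra.
From mathcomp Require Import polyrcf reals.

Set Implicit Arguments.
Unset Strict Implicit.
Unset Printing Implicit Defensive.

Import Order.TTheory GRing.Theory Num.Theory.
Local Open Scope ring_scope.

Record sgraph (n : nat) := SGraph {
  edge :> rel 'I_n;
  edge_sym : symmetric edge;
  edge_irr : irreflexive edge }.

Section Spectrum.
Variable R : realType.

Definition adjacency n (G : sgraph n) : 'M[R]_n :=
  \matrix_(u, v) (G u v)%:R.

(* theta_0 > ... > theta_d; rootsR lists the distinct real roots increasingly *)
Definition eigenvalues n (A : 'M[R]_n) : seq R := rev (rootsR (char_poly A)).

Definition multiplicity n (A : 'M[R]_n) (x : R) : nat := mup x (char_poly A).

Lemma mem_eigenvalues n (A : 'M[R]_n) x :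
  (x \in eigenvalues A) = eigenvalue A x.
Proof.
have nz : char_poly A != 0 by rewrite monic_neq0 ?char_poly_monic.
by rewrite mem_rev eigenvalue_root_char -(roots_on_rootsR nz).
Qed.

Lemma eigenvalues_sorted n (A : 'M[R]_n) : sorted >%R (eigenvalues A).
Proof. by rewrite /eigenvalues rev_sorted; apply: sorted_roots. Qed.

Definition feasible n (A : 'M[R]_n) (p : {poly R}) : Prop :=
  (size p <= 2)%N /\ forall v : 'I_n, 0 <= (p`_0 *: 1%:M + p`_1 *: A) v v.

Definition objective n (A : 'M[R]_n) (p : {poly R}) : nat :=
  (\sum_(x <- eigenvalues A | (0 <= p.[x])%R) multiplicity A x)%N.

Definition is_mu1 n (G : sgraph n) (m : nat) : Prop :=
  let A := adjacency G in
  (exists2 p, feasible A p & objective A p = m) /\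
  (forall p, feasible A p -> (m <= objective A p)%N).

End Spectrum.

(* Real RAM: finitely many natural and real registers (those named in the      *)
(* program) and two unbounded memories, addressed indirectly through natural   *)
(* registers. Every instruction and every test has unit cost, except Eig.      *)
(* Real arithmetic is exact, the only real constants are 0 and 1, there is no  *)
(* conversion from reals to naturals, and natural registers only have + and    *)
(* truncated -, so that unit-cost products of large integers are unavailable.  *)

Inductive instr :=
| NConst of nat & nat          (* n_i := k *)
| NAdd of nat & nat & nat      (* n_i := n_j + n_k *)
| NSub of nat & nat & nat      (* n_i := n_j - n_k *)
| NLoad of nat & nat           (* n_i := N[n_j] *)
| NStore of nat & nat          (* N[n_i] := n_j *)
| RZero of nat                 (* r_i := 0 *)
| ROne of nat                  (* r_i := 1 *)
| RAdd of nat & nat & nat      (* r_i := r_j + r_k *)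
| RSub of nat & nat & nat      (* r_i := r_j - r_k *)
| RMul of nat & nat & nat      (* r_i := r_j * r_k *)
| RDiv of nat & nat & nat      (* r_i := r_j / r_k *)
| RLoad of nat & nat           (* r_i := R[n_j] *)
| RStore of nat & nat          (* R[n_i] := r_j *)
| Eig of nat & nat.            (* spectral preprocessing, see [step] *)

Inductive test :=
| NLt of nat & nat             (* n_i < n_j *)
| RLt of nat & nat.            (* r_i < r_j *)

Inductive prog :=
| Do of instr
| Seq of prog & prog
| If of test & prog & prog
| While of test & prog.

Definition upd (T : Type) (f : nat -> T) (i : nat) (x : T) : nat -> T :=
  fun k => if k == i then x else f k.

Section Machine.
Variable R : realType.

Record state := State {
  nreg : nat -> nat;
  rreg : nat -> R;
  nmem : nat -> nat;
  rmem : nat -> R }.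

Definition set_nreg s i x := State (upd (nreg s) i x) (rreg s) (nmem s) (rmem s).
Definition set_rreg s i x := State (nreg s) (upd (rreg s) i x) (nmem s) (rmem s).
Definition set_nmem s i x := State (nreg s) (rreg s) (upd (nmem s) i x) (rmem s).
Definition set_rmem s i x := State (nreg s) (rreg s) (nmem s) (upd (rmem s) i x).

(* the n x n matrix stored row by row from real address 0 *)
Definition stored_matrix (s : state) (n : nat) : 'M[R]_n :=
  \matrix_(i, j) rmem s (i * n + j)%N.

(* [Eig i j], with n = n_i and A the stored n x n matrix: n_j receives the     *)
(* number d + 1 of distinct eigenvalues of A, and for k <= d, R[k] receives    *)
(* theta_k and N[k] receives m_k.                                              *)
Definition eig_step (i j : nat) (s : state) : state :=
  let A := stored_matrix s (nreg s i) in
  let th := eigenvalues A in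
  State (upd (nreg s) j (size th)) (rreg s)
    (fun k => if (k < size th)%N then multiplicity A th`_k else nmem s k)
    (fun k => if (k < size th)%N then th`_k else rmem s k).

Definition step (a : instr) (s : state) : state :=
  match a with
  | NConst i k => set_nreg s i k
  | NAdd i j k => set_nreg s i (nreg s j + nreg s k)%N
  | NSub i j k => set_nreg s i (nreg s j - nreg s k)%N
  | NLoad i j => set_nreg s i (nmem s (nreg s j))
  | NStore i j => set_nmem s (nreg s i) (nreg s j)
  | RZero i => set_rreg s i 0
  | ROne i => set_rreg s i 1
  | RAdd i j k => set_rreg s i (rreg s j + rreg s k)
  | RSub i j k => set_rreg s i (rreg s j - rreg s k)
  | RMul i j k => set_rreg s i (rreg s j * rreg s k)
  | RDiv i j k => set_rreg s i (rreg s j / rreg s k)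
  | RLoad i j => set_rreg s i (rmem s (nreg s j))
  | RStore i j => set_rmem s (nreg s i) (rreg s j)
  | Eig i j => eig_step i j s
  end.

Definition eval (b : test) (s : state) : bool :=
  match b with
  | NLt i j => (nreg s i < nreg s j)%N
  | RLt i j => rreg s i < rreg s j
  end.

(* [T n] is the time spent by the spectral preprocessing of an n x n matrix *)
Definition cost (T : nat -> nat) (a : instr) (s : state) : nat :=
  if a is Eig i _ then T (nreg s i) else 1%N.

(* [exec T c s t s']: started in s, the program c halts in s' after time t *)
Inductive exec (T : nat -> nat) : prog -> state -> nat -> state -> Prop :=
| ExecDo a s : exec T (Do a) s (cost T a s) (step a s)
| ExecSeq c1 c2 s t1 s1 t2 s2 :
    exec T c1 s t1 s1 -> exec T c2 s1 t2 s2 ->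
    exec T (Seq c1 c2) s (t1 + t2)%N s2
| ExecIf b c1 c2 s t s' :
    exec T (if eval b s then c1 else c2) s t s' ->
    exec T (If b c1 c2) s t.+1 s'
| ExecWhileF b c s : ~~ eval b s -> exec T (While b c) s 1%N s
| ExecWhileT b c s t1 s1 t2 s2 :
    eval b s -> exec T c s t1 s1 -> exec T (While b c) s1 t2 s2 ->
    exec T (While b c) s (t1 + t2).+1 s2.

(* n_0 holds n, real memory holds A row by row, and all the rest is zero *)
Definition input n (A : 'M[R]_n) : state :=
  State (upd (fun=> 0%N) 0 n) (fun=> 0) (fun=> 0%N)
    (fun k => \sum_(i < n) \sum_(j < n | k == (i * n + j)%N) A i j).

Lemma stored_input n (A : 'M[R]_n) : stored_matrix (input A) n = A.
Proof.
apply/matrixP => i j; rewrite mxE /=.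
have eq_addr (i' j' : 'I_n) :
    (i * n + j == i' * n + j')%N = (i' == i) && (j' == j).
  apply/eqP/andP => [e|[/eqP-> /eqP->]//].
  have n0 : (0 < n)%N := leq_ltn_trans (leq0n _) (ltn_ord i).
  have /(congr1 (divn^~ n)) := e; have /(congr1 (modn^~ n)) := e.
  rewrite /= !modnMDl !divnMDl // !modn_small // !divn_small // !addn0 => ej ei.
  by split; apply/eqP/val_inj.
rewrite (bigD1 i) //= [X in _ + X]big1 => [|i' ne]; last first.
  by rewrite big1 // => j'; rewrite eq_addr (negPf ne).
rewrite addr0 (bigD1 j) ?eq_addr ?eqxx //= big1 ?addr0 // => j'.
by rewrite eq_addr eqxx /= andbN.
Qed.

(* on every graph G with n vertices, c halts within time f n with mu_1(G) in n_0 *)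
Definition computes_mu1 (T : nat -> nat) (c : prog) (f : nat -> nat) : Prop :=
  forall n (G : sgraph n), exists t s,
    [/\ exec T c (input (adjacency R G)) t s,
        is_mu1 R G (nreg s 0) & (t <= f n)%N].

End Machine.

Fixpoint eig_free (c : prog) : bool :=
  match c with
  | Do a => if a is Eig _ _ then false else true
  | Seq c1 c2 => eig_free c1 && eig_free c2
  | If _ c1 c2 => eig_free c1 && eig_free c2
  | While _ c1 => eig_free c1
  end.

Definition bigO (f g : nat -> nat) : Prop :=
  exists C N : nat, forall n, (N <= n -> f n <= C * g n)%N.

Definition computes_mu1_in (R : realType) (T : nat -> nat) (c : prog)
    (g : nat -> nat) : Prop :=
  exists2 f, bigO f g & computes_mu1 R T c f.

(* Main.v *)
Require Import Defs.
From mathcomp Require Import all_boot all_order all_algebra.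
From mathcomp Require Import polyrcf complex reals.
From mathcomp Require Import ring lra zify.

(* The diagonal of A is zero, so p = a + b x is feasible iff a >= 0, and then    *)
(* {p >= 0} contains {x >= 0} or {x <= 0}. Hence the optimum is attained at x or *)
(* -x, and mu_1 = n - max(n_+, n_-), where n_+ and n_- count the positive and    *)
(* negative eigenvalues. With the spectrum at hand this is a single scan.        *)
(* Without it, the inertia (n_+, n_-) is obtained by symmetric elimination: as   *)
(* long as M <> 0, some v = e_i + e_j has q = v M v^T <> 0, and replacing M by   *)
(* M - (v M)^T (v M) / q lowers the rank and removes one eigenvalue of the sign  *)
(* of q (Sylvester). At most n rounds occur, each costing O(n^2).                *)

Set Implicit Arguments.
Unset Strict Implicit.
Unset Printing Implicit Defensive.

Import Order.TTheory GRing.Theory Num.Theory.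
Local Open Scope ring_scope.

(** * Inertia of real symmetric matrices *)

(** A symmetric [A] is similar to a real diagonal matrix with diagonal [d] ([sym_diagonalizable]),
    so sums of multiplicities become counts of entries of [d] ([sum_multiplicity]), and
    [is_mu1_inertia] reduces the minimisation to the numbers of positive and negative entries.
    Scanning a given spectrum for these takes linear time ([runs_count_spectrum]), which any
    preprocessing of at least linear cost absorbs.

    For a cubic bound whatever the cost of [Eig], the eigenvalues must be avoided: field operations
    and comparisons on a 0-1 matrix produce only rationals. Elimination ([inertia_split_step])
    tracks subspaces of known codimension on which the form of [A] is compared with that of the
    remainder. Once the remainder is zero, [card_pos_le] and the rank turn these codimensions into
    the exact counts ([inertia_split_end]). A pivot exists as long as the remainder is nonzero
    ([sym_eq0]), and [runs_inertia_prog] transfers the argument to the program. *)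

Lemma char_poly_similar (F : fieldType) n (A B P : 'M[F]_n) :
  P \in unitmx -> P *m A = B *m P -> char_poly A = char_poly B.
Proof.
move=> Pu PA; pose Q := map_mx polyC P.
have Q0 : \det Q != 0.
  by rewrite det_map_mx polyC_eq0 -unitfE -unitmxE.
apply: (mulfI Q0); rewrite [RHS]mulrC -!det_mulmx; congr (\det _).
rewrite /char_poly_mx mulmxBr mulmxBl -!map_mxM PA.
by rewrite scalar_mxC.
Qed.

Lemma rank_diag_le (F : fieldType) n (d : 'rV[F]_n) :
  (\rank (diag_mx d) <= #|[set i | (d 0 i != 0)%R]|)%N.
Proof.
set S := [set i | _]; pose h (a : 'I_#|S|) : 'I_n := enum_val a.
suff -> : diag_mx d = colsub h (diag_mx d) *m rowsub h 1%:M.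
  by apply: leq_trans (mxrankM_maxl _ _) _; apply: rank_leq_col.
apply/matrixP => i j; rewrite !mxE.
have [di|di] := eqVneq (d 0 i) 0.
  rewrite di mul0rn big1 // => a _; rewrite !mxE.
  by rewrite di mul0rn mul0r.
have iS : i \in S by rewrite inE.
rewrite (bigD1 (enum_rank_in iS i)) //= !mxE /h enum_rankK_in // eqxx mulr1n.
rewrite big1 ?addr0 ?mulr_natr // => a ai; rewrite !mxE.
case: eqP => [ia|]; last by rewrite mulr0n mul0r.
by case/eqP: ai; apply: enum_val_inj; rewrite enum_rankK_in.
Qed.

Section SymmetricMatrices.
Variable R : rcfType.

(** The spectral theorem for Hermitian matrices applies over [R[i]]. The eigenvalues are real, and
    real matrices similar over [R[i]] are similar through a real matrix. That matrix is only known
    to be invertible, so orthogonality of eigenvectors is later recovered from the symmetry of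
    [A]. *)
Lemma sym_diagonalizable n (A : 'M[R]_n) : A^T = A ->
  exists (d : 'rV[R]_n) (P : 'M[R]_n), P \in unitmx /\ P *m A = diag_mx d *m P.
Proof.
move=> symA; pose f : {rmorphism R -> R[i]} := real_complex R.
pose AC := map_mx f A.
have realAC : AC \is a realmx.
  by apply/mxOverP => i j; rewrite mxE complex_real.
have hermAC : AC \is hermsymmx.
  apply: realsym_hermsym => //; apply/is_hermitianmxP.
  rewrite expr0 scale1r; apply/matrixP => i j; rewrite !mxE.
  by rewrite -{1}symA mxE.
have realD := hermitian_spectral_diag_real hermAC.
have /orthomx_spectralP AE := hermitian_normalmx hermAC.
set Q := spectralmx AC in AE; set e := spectral_diag AC in AE realD.
have Qu : Q \in unitmx by apply: spectral_unit.
pose d := map_mx (@complex.Re R) e.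
have eE : e = map_mx f d.
  apply/matrixP => i j; rewrite !mxE.
  by have /mxOverP/(_ i j) /RRe_real := realD.
have realDD : diag_mx e \is a realmx.
  apply/mxOverP => i j; rewrite mxE; case: eqP => _; last by rewrite mulr0n real0.
  by rewrite mulr1n; have /mxOverP := realD; apply.
have [P] : similar_in [predI realmx & unitmx] AC (diag_mx e).
  apply: real_similar => //; exists Q => //.
  apply/similarP => //.
  by rewrite {1}AE !mulmxA mulmxV // mul1mx.
rewrite inE => /andP[realP Pu] /(similarP Pu) PE.
exists d, (map_mx (@complex.Re R) P).
have PP : P = map_mx f (map_mx (@complex.Re R) P).
  apply/matrixP => i j; rewrite !mxE.
  by have /mxOverP/(_ i j) /RRe_real := realP.
split; first by move: Pu; rewrite {1}PP map_unitmx.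
apply: (@map_mx_inj _ _ f); rewrite !map_mxM map_diag_mx -PP -eE.
exact: PE.
Qed.

Definition qform n (A : 'M[R]_n) (x : 'rV[R]_n) : R := (x *m A *m x^T) 0 0.

Lemma row_normsq_eq0 n (x : 'rV[R]_n) : (x *m x^T) 0 0 <= 0 -> x = 0.
Proof.
rewrite mxE => s0; apply/rowP => i; rewrite [RHS]mxE; apply/eqP.
rewrite -sqrf_eq0 eq_le sqr_ge0 andbT; apply: le_trans s0.
rewrite (bigD1 i) //= !mxE -expr2 lerDl sumr_ge0 // => j _.
by rewrite mxE -expr2 sqr_ge0.
Qed.

(* Rows of [V] with different eigenvalues are orthogonal, so the eigenvalue     *)
(* [e_i] next to [(V V^T)_ij] may be replaced by [sqrt e_i * sqrt e_j].         *)
Lemma eigenrows_positive m n (A : 'M[R]_n) (V : 'M[R]_(m, n)) (e : 'rV[R]_m) y :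
    A^T = A -> row_free V -> V *m A = diag_mx e *m V -> (forall i, 0 < e 0 i) ->
  qform A (y *m V) <= 0 -> y = 0.
Proof.
move=> symA freeV VA e0.
pose G := V *m V^T; pose r := \row_i Num.sqrt (e 0 i).
have rE : diag_mx e *m G = diag_mx r *m G *m diag_mx r.
  have comm : diag_mx e *m G = G *m diag_mx e.
    rewrite mulmxA -VA -mulmxA -{1}symA -trmx_mul VA trmx_mul tr_diag_mx.
    by rewrite mulmxA.
  apply/matrixP => i j; move/matrixP/(_ i j): comm.
  rewrite mul_diag_mx mul_mx_diag mul_mx_diag mul_diag_mx !mxE => eG.
  have [->|/mulIf] := eqVneq (\sum_k V i k * V^T k j) 0.
    by rewrite !(mulr0, mul0r).
  rewrite mulrC [RHS]mulrC mulrA => inj.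
  have eij : e 0 i = e 0 j by apply: inj; rewrite eG mulrC.
  by rewrite eij -expr2 sqr_sqrtr 1?mulrC // ltW.
(* The form at [y *m V] is thus the squared norm of [y *m diag_mx r *m V], and its nonpositivity
   makes that row vanish. *)
have yE : y *m V *m A *m (y *m V)^T =
    (y *m diag_mx r *m V) *m (y *m diag_mx r *m V)^T.
  transitivity (y *m (diag_mx e *m G) *m y^T).
    by rewrite /G trmx_mul !mulmxA -(mulmxA y V A) VA !mulmxA.
  by rewrite rE /G !trmx_mul tr_diag_mx !mulmxA.
rewrite /qform yE => /row_normsq_eq0 /eqP.
rewrite mulmx_free_eq0 // => /eqP yr; apply/rowP => i.
move/rowP/(_ i): yr; rewrite mul_mx_diag !mxE => /eqP.
by rewrite mulf_eq0 sqrtr_eq0 leNgt e0 orbF => /eqP.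
Qed.

(** With more than [k] positive eigenvalues, the span of their eigenrows would meet the left kernel
    of [W], of codimension at most [k], in a nonzero vector, where the form would be both positive
    and nonpositive. *)
Lemma card_pos_le n (A P : 'M[R]_n) (d : 'rV[R]_n) k (W : 'M[R]_(n, k)) :
    A^T = A -> P \in unitmx -> P *m A = diag_mx d *m P ->
    (forall x, x *m W = 0 -> qform A x <= 0) ->
  (#|[set i | (0 < d 0 i)%R]| <= k)%N.
Proof.
move=> symA Pu PA neg; set S := [set i | _]; rewrite leqNgt; apply/negP => kS.
pose h (a : 'I_#|S|) : 'I_n := enum_val a.
pose V := rowsub h P.
have freeV : row_free V.
  apply/row_freeP; exists (colsub h (invmx P)).
  rewrite -mxsub_mul mulmxV //; apply/matrixP => i j; rewrite !mxE.
  by rewrite (inj_eq enum_val_inj).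
have VA : V *m A = diag_mx (colsub h d) *m V.
  rewrite mul_rowsub_mx PA; apply/matrixP => i j.
  by rewrite [LHS]mxE !mul_diag_mx !mxE.
have [y yW y0] : exists2 y : 'rV_#|S|, y *m (V *m W) = 0 & y != 0.
  have : kermx (V *m W) != 0.
    by rewrite -mxrank_eq0 mxrank_ker subn_eq0 -ltnNge
               (leq_ltn_trans _ kS) // rank_leq_col.
  by case/rowV0Pn => y /sub_kermxP yV y0; exists y.
move/eqP: y0; apply; apply: (eigenrows_positive symA freeV VA).
  by move=> i; rewrite mxE; have := enum_valP i; rewrite inE.
by apply: neg; rewrite -mulmxA.
Qed.

(* [elim_step] subtracts from [M] the rank-one form that agrees with it on [v]; *)
(* for an isotropic [v] it does nothing, as [0^-1 = 0].                         *)
Definition elim_step n (M : 'M[R]_n) (v : 'rV[R]_n) : 'M[R]_n :=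
  M - (qform M v)^-1 *: ((v *m M)^T *m (v *m M)).

Lemma elim_step_sym n (M : 'M[R]_n) v : M^T = M -> (elim_step M v)^T = elim_step M v.
Proof.
by move=> symM; rewrite /elim_step linearB linearZ /= trmx_mul trmxK symM.
Qed.

Lemma qform_elim_step n (M : 'M[R]_n) v x : M^T = M ->
  qform (elim_step M v) x = qform M x - (qform M v)^-1 * ((x *m (v *m M)^T) 0 0) ^+ 2.
Proof.
move=> symM; rewrite /elim_step {1}/qform mulmxBr mulmxBl mxE; congr (_ + _).
rewrite [LHS]mxE -scalemxAr -scalemxAl mxE; congr (- (_ * _)).
move: (v *m M) => w.
have -> : x *m (w^T *m w) *m x^T = (x *m w^T) *m (x *m w^T)^T.
  by rewrite trmx_mul trmxK !mulmxA.
by rewrite [LHS]mxE big_ord1 [_^T _ _]mxE expr2.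
Qed.

(* The kernel grows: it still contains the kernel of [M], and now also [v]. *)
Lemma rank_elim_step n (M : 'M[R]_n) v : M^T = M -> qform M v != 0 ->
  (\rank (elim_step M v) < \rank M)%N.
Proof.
move=> symM q0; set M' := elim_step M v.
have vM' : v *m M' = 0.
  rewrite /M' /elim_step mulmxBr -scalemxAr [X in _ *: X]mulmxA [v *m _^T]mx11_scalar.
  have -> : (v *m (v *m M)^T) 0 0 = qform M v by rewrite trmx_mul symM mulmxA.
  by rewrite mul_scalar_mx scalerA mulVf // scale1r subrr.
have kerS : (kermx M < kermx M')%MS.
  rewrite ltmxE; apply/andP; split.
    apply/sub_kermxP; rewrite /M' /elim_step mulmxBr -scalemxAr trmx_mul symM.
    by rewrite !mulmxA mulmx_ker !mul0mx scaler0 subrr.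
  have /submx_trans vk : (v <= kermx M')%MS by apply/sub_kermxP.
  apply/negP => /vk /sub_kermxP vM.
  by move: q0; rewrite /qform vM mul0mx mxE eqxx.
have := rank_ltmx kerS; rewrite !mxrank_ker.
have := rank_leq_row M; have := rank_leq_row M'; lia.
Qed.

(* Once [M = 0], the form of [A] is nonpositive on a subspace of codimension at  *)
(* most [a] and nonnegative on one of codimension at most [b], so [A] has at     *)
(* most [a] positive and [b] negative eigenvalues; the rank forces equality.     *)
Definition inertia_split n (A M : 'M[R]_n) (a b : nat) : Prop :=
  [/\ M^T = M,
      exists U : 'M[R]_(n, a), forall x, x *m U = 0 -> qform A x <= qform M x,
      exists V : 'M[R]_(n, b), forall x, x *m V = 0 -> qform M x <= qform A x
    & (\rank M + a + b <= \rank A)%N].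

Lemma inertia_split0 n (A : 'M[R]_n) : A^T = A -> inertia_split A A 0 0.
Proof.
by move=> symA; split=> //; [exists 0|exists 0|rewrite !addn0].
Qed.

(** The subtracted rank-one form has the sign of the pivot value, so one of the two comparisons
    survives as it is. The other survives on the vectors that are [M]-orthogonal to [v], at the
    price of one more column. *)
Lemma inertia_split_step n (A M : 'M[R]_n) a b v :
    inertia_split A M a b -> qform M v != 0 ->
  inertia_split A (elim_step M v) (a + (0 < qform M v)%R) (b + (qform M v < 0)%R).
Proof.
move=> [symM [U UP] [V VP] rk] q0.
have rk' := rank_elim_step symM q0; have symM' := elim_step_sym v symM.
have ext c (W : 'M[R]_(n, c)) : exists W' : 'M[R]_(n, c + 1), forall x,
    x *m W' = 0 -> x *m W = 0 /\ qform (elim_step M v) x = qform M x.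
  exists (row_mx W (v *m M)^T) => x; rewrite mul_mx_row.
  move/eqP; rewrite row_mx_eq0 => /andP[/eqP xW /eqP xw]; split => //.
  by rewrite qform_elim_step // xw mxE expr0n mulr0 subr0.
case: (ltgtP (qform M v) 0) (q0) => // sq _; rewrite ?addn0.
- have [V' V'P] := ext b V; split => //; last lia.
    exists U => x /UP /le_trans-> //; rewrite qform_elim_step //.
    by rewrite lerBrDl gerDr mulr_le0_ge0 ?sqr_ge0 // invr_le0 ltW.
  by exists V' => x /V'P[xV ->]; apply: VP.
- have [U' U'P] := ext a U; split => //; last lia.
    by exists U' => x /U'P[xU ->]; apply: UP.
  exists V => x /VP; apply: le_trans; rewrite qform_elim_step //.
  by rewrite gerBl mulr_ge0 ?sqr_ge0 // invr_ge0 ltW.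
Qed.

Lemma inertia_split_end n (A P : 'M[R]_n) (d : 'rV[R]_n) a b :
    A^T = A -> P \in unitmx -> P *m A = diag_mx d *m P ->
    inertia_split A 0 a b ->
  a = #|[set i | (0 < d 0 i)%R]| /\ b = #|[set i | (d 0 i < 0)%R]|.
Proof.
move=> symA Pu PA [_ [U UP] [V VP] rk].
have qf0 x : qform (0 : 'M[R]_n) x = 0 by rewrite /qform mulmx0 mul0mx mxE.
have ha : (#|[set i | (0 < d 0 i)%R]| <= a)%N.
  by apply: (card_pos_le symA Pu PA (W := U)) => x /UP; rewrite qf0.
have hb : (#|[set i | (d 0 i < 0)%R]| <= b)%N.
  (* Negative eigenvalues of [A] are positive ones of [- A], diagonalised by the same [P]. *)
  have -> : [set i | (d 0 i < 0)%R] = [set i | (0 < (- d) 0 i)%R].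
    by apply/setP => i; rewrite !inE mxE oppr_gt0.
  apply: (card_pos_le (A := - A) (P := P) (W := V)) => //.
  - by rewrite linearN /= symA.
  - by rewrite mulmxN PA linearN /= mulNmx.
  - by move=> x /VP; rewrite qf0 /qform mulmxN mulNmx [in X in _ -> X]mxE oppr_le0.
have hr : (\rank A <= #|[set i | (0 < d 0 i)%R]| + #|[set i | (d 0 i < 0)%R]|)%N.
  have <- : \rank (P *m A) = \rank A.
    by have /(eqmxMfull A) -> : row_full P by rewrite row_full_unit.
  rewrite PA mxrankMfree ?row_free_unit //; apply: leq_trans (rank_diag_le _) _.
  apply: leq_trans (leq_card_setU _ _); apply/subset_leq_card/subsetP => i.
  by rewrite !inE neq_lt orbC.
move: rk; rewrite mxrank0; lia.
Qed.

Lemma qform_delta2 n (M : 'M[R]_n) i j :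
  qform M (delta_mx 0 i + delta_mx 0 j) = M i i + M i j + M j i + M j j.
Proof.
rewrite /qform linearD /= mulmxDr !mulmxDl !trmx_delta.
by rewrite -!rowE -!colE !mxE addrACA !addrA; ring.
Qed.

Lemma elim_step_delta2 n (M : 'M[R]_n) i j k l (v := delta_mx 0 i + delta_mx 0 j) :
  elim_step M v k l = M k l - (M i k + M j k) * (M i l + M j l) / qform M v.
Proof.
rewrite /elim_step mulmxDl -!rowE mxE [X in _ + X]mxE [in X in _ - X]mxE.
by rewrite [(_ *m _) _ _]mxE big_ord1 !mxE mulrC.
Qed.

(** Polarisation: [i = j] gives four times a diagonal entry, and then [i != j] gives twice an
    off-diagonal one. Hence a search over these vectors finds a pivot or certifies [M = 0]. *)
Lemma sym_eq0 n (M : 'M[R]_n) : M^T = M ->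
  (forall i j, qform M (delta_mx 0 i + delta_mx 0 j) = 0) -> M = 0.
Proof.
move=> symM M0.
have symij i j : M j i = M i j by rewrite -[in RHS]symM mxE.
have dM i : M i i = 0 by have := M0 i i; rewrite qform_delta2; lra.
by apply/matrixP => i j; have := M0 i j; rewrite qform_delta2 !dM symij mxE; lra.
Qed.

End SymmetricMatrices.

(** * The value of mu_1 *)

Lemma sum_count_mem (T : eqType) (s e : seq T) (p : pred T) :
  uniq e -> {subset s <= e} -> (\sum_(x <- e | p x) count_mem x s)%N = count p s.
Proof.
move=> ue; elim: s => [|y s IHs] se; first by rewrite big1.
have ye : y \in e by apply: se; rewrite mem_head.
rewrite /= big_split /= IHs => [|x xs]; last by apply: se; rewrite inE xs orbT.
congr (_ + _)%N; transitivity (\sum_(x <- e | x == y) p x)%N; last first.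
  by rewrite -big_filter filter_pred1_uniq // big_seq1.
rewrite big_mkcond [RHS]big_mkcond; apply: eq_bigr => x _.
by rewrite eq_sym; case: eqP => [->|]; case: (p _).
Qed.

Section Mu1.
Variable R : realType.

(** By similarity the characteristic polynomial is the product of the ['X - (d 0 i)%:P], so the
    multiplicity of [x] is its number of occurrences in [d]. *)
Lemma sum_multiplicity n (A P : 'M[R]_n) (d : 'rV[R]_n) (p : pred R) :
    P \in unitmx -> P *m A = diag_mx d *m P ->
  (\sum_(x <- eigenvalues A | p x) multiplicity A x)%N = #|[set i | p (d 0 i)]|.
Proof.
move=> Pu PA; pose s := [seq d 0 i | i <- enum 'I_n].
have cpE : char_poly A = \prod_(x <- s) ('X - x%:P).
  rewrite (char_poly_similar Pu PA) char_poly_trig ?diag_mx_is_trig //.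
  rewrite big_map [RHS]big_enum /=; apply: eq_bigr => i _.
  by rewrite mxE eqxx mulr1n.
have eigE : eigenvalues A =i s.
  by move=> x; rewrite mem_eigenvalues eigenvalue_root_char cpE root_prod_XsubC.
have uniqE : uniq (eigenvalues A).
  by rewrite rev_uniq; apply: uniq_roots.
transitivity (count p s); last first.
  rewrite count_map -sum1_count big_enum_cond /= -sum1_card.
  by apply: eq_bigl => i; rewrite inE.
under eq_bigr => x _ do rewrite /multiplicity cpE mu_prod_XsubC.
by apply: sum_count_mem => // x; rewrite eigE.
Qed.

Lemma is_mu1_inertia n (G : sgraph n) (P : 'M[R]_n) (d : 'rV[R]_n) :
    P \in unitmx -> P *m adjacency R G = diag_mx d *m P ->
  is_mu1 R G (n - maxn #|[set i | (0 < d 0 i)%R]| #|[set i | (d 0 i < 0)%R]|)%N.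
Proof.
move=> Pu PA.
have objE p : objective (adjacency R G) p = #|[set i | (0 <= p.[d 0 i])%R]|.
  exact: (sum_multiplicity _ Pu PA).
have cardC (S : {set 'I_n}) : #|~: S| = (n - #|S|)%N.
  by rewrite cardsCs setCK card_ord.
have ge0E : #|[set i | (0 <= d 0 i)%R]| = (n - #|[set i | (d 0 i < 0)%R]|)%N.
  by rewrite -cardC; apply: eq_card => i; rewrite !inE leNgt.
have le0E : #|[set i | (d 0 i <= 0)%R]| = (n - #|[set i | (0 < d 0 i)%R]|)%N.
  by rewrite -cardC; apply: eq_card => i; rewrite !inE leNgt.
have adjD v : adjacency R G v v = 0 by rewrite mxE edge_irr.
have objX : objective (adjacency R G) 'X = #|[set i | (0 <= d 0 i)%R]|.
  by rewrite objE; apply: eq_card => i; rewrite !inE hornerX.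
have objNX : objective (adjacency R G) (- 'X) = #|[set i | (d 0 i <= 0)%R]|.
  by rewrite objE; apply: eq_card => i; rewrite !inE hornerN hornerX oppr_ge0.
split.
  case: (leqP #|[set i | (0 < d 0 i)%R]| #|[set i | (d 0 i < 0)%R]|) => _.
    exists 'X; last by rewrite objX ge0E.
    split; first by rewrite size_polyX.
    by move=> v; rewrite mxE [X in X + _]mxE [X in _ + X]mxE adjD !coefX /= mul0r mulr0 addr0.
  exists (- 'X); last by rewrite objNX le0E.
  split; first by rewrite size_polyN size_polyX.
  move=> v; rewrite mxE [X in X + _]mxE [X in _ + X]mxE adjD !coefN !coefX /=.
  by rewrite oppr0 mul0r mulr0 addr0.
move=> p [sp pos]; have [n0|n0] := posnP n.
  have n_le0 : (n <= 0)%N by rewrite n0.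
  exact: leq_trans (leq_subr _ _) (leq_trans n_le0 (leq0n _)).
have p0 : 0 <= p`_0.
  have := pos (Ordinal n0); rewrite mxE [X in X + _]mxE [X in _ + X]mxE adjD.
  by rewrite mulr0 addr0 mxE eqxx mulr1.
have pE x : p.[x] = p`_0 + p`_1 * x.
  by rewrite (horner_coef_wide _ sp) big_ord_recl big_ord1 /= expr0 mulr1 expr1.
rewrite objE; have [p1|p1] := leP 0 p`_1.
  apply: leq_trans (_ : #|[set i | (0 <= d 0 i)%R]| <= _)%N.
    by rewrite ge0E leq_sub2l // leq_maxr.
  apply/subset_leq_card/subsetP => i; rewrite !inE pE => di.
  by rewrite addr_ge0 // mulr_ge0.
apply: leq_trans (_ : #|[set i | (d 0 i <= 0)%R]| <= _)%N.
  by rewrite le0E leq_sub2l // leq_maxl.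
apply/subset_leq_card/subsetP => i; rewrite !inE pE => di.
by rewrite addr_ge0 // mulr_le0 // ltW.
Qed.

End Mu1.

(** * Timed Hoare triples *)

(** The first instruction is a separate argument because there is no empty program. *)
Fixpoint block (a : instr) (l : seq instr) : prog :=
  if l is b :: l' then Seq (Do a) (block b l') else Do a.

(** [one] names a register assumed to hold 1, since addition takes only registers. *)
Definition for_loop (one i e : nat) (body : prog) : prog :=
  Seq (Do (NConst i 0))
      (While (NLt i e) (Seq body (Do (NAdd i i one)))).

Section Runs.
Variables (R : realType) (T : nat -> nat).
Implicit Types (s : state R) (c : prog) (Q : state R -> Prop).

Definition runs c s Q (b : nat) : Prop :=
  exists t s', [/\ exec T c s t s', Q s' & (t <= b)%N].

Lemma runs_weaken c s Q Q' b b' :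
  runs c s Q b -> (forall s', Q s' -> Q' s') -> (b <= b')%N -> runs c s Q' b'.
Proof.
by move=> [t [s' [ex q tb]]] QQ bb; exists t, s'; split; [|apply: QQ|apply: leq_trans bb].
Qed.

Lemma runs_post c s Q Q' b :
  runs c s Q b -> (forall s', Q s' -> Q' s') -> runs c s Q' b.
Proof. by move=> r QQ; apply: runs_weaken r QQ _. Qed.

Lemma runs_le b c s Q b' : runs c s Q b -> (b <= b')%N -> runs c s Q b'.
Proof. by move=> r; apply: runs_weaken r _. Qed.

Lemma runs_seq c1 c2 s Q1 Q b1 b2 :
    runs c1 s Q1 b1 -> (forall s', Q1 s' -> runs c2 s' Q b2) ->
  runs (Seq c1 c2) s Q (b1 + b2).
Proof.
move=> [t1 [s1 [ex1 q1 tb1]]] /(_ _ q1) [t2 [s2 [ex2 q2 tb2]]].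
by exists (t1 + t2)%N, s2; split=> //; [apply: ExecSeq ex1 ex2|apply: leq_add].
Qed.

Lemma runs_do a s Q : eig_free (Do a) -> Q (step a s) -> runs (Do a) s Q 1.
Proof.
move=> na q; exists (cost T a s), (step a s); split=> //; first exact: ExecDo.
by case: a na {q}.
Qed.

Lemma runs_cons a c s Q b : eig_free (Do a) ->
  runs c (step a s) Q b -> runs (Seq (Do a) c) s Q b.+1.
Proof.
move=> na r; rewrite -add1n.
by apply: (runs_seq (Q1 := fun s' => s' = step a s)) => [|_ ->]; first exact: runs_do.
Qed.

Lemma runs_if tst c1 c2 s Q b :
  runs (if eval tst s then c1 else c2) s Q b -> runs (If tst c1 c2) s Q b.+1.
Proof. by move=> [t [s' [ex q tb]]]; exists t.+1, s'; split=> //; apply: ExecIf. Qed.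

(** [I k] describes the state at the loop head after [k] rounds. Each round pays for the test and
    the increment besides the body; the initialisation and the failing last test add 2. *)
Lemma runs_for one i e body (I : nat -> state R -> Prop) N b s :
    I 0%N (set_nreg s i 0%N) ->
    (forall k s', (k <= N)%N -> I k s' -> nreg s' i = k /\ nreg s' e = N) ->
    (forall k s', (k < N)%N -> I k s' ->
      runs body s' (fun s'' => I k.+1 (step (NAdd i i one) s'')) b) ->
  runs (for_loop one i e body) s (I N) (N * b.+2 + 2)%N.
Proof.
move=> I0 Ireg Istep; rewrite /for_loop addnC -(addn1 1) -addnA.
apply: (runs_seq (Q1 := I 0%N)); first exact: runs_do.
suff loop m k s' : (k + m = N)%N -> I k s' ->
    runs (While (NLt i e) (Seq body (Do (NAdd i i one)))) s' (I N) (1 + m * b.+2)%N.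
  by move=> s'; apply: loop; rewrite add0n.
elim: m k s' => [|m IHm] k s' kN Ik.
  exists 1%N, s'; rewrite addn0 in kN; split=> //; last by rewrite kN in Ik.
  apply: ExecWhileF; have [|/= -> ->] := Ireg k s' _ Ik; first by rewrite kN.
  by rewrite kN ltnn.
have kN' : (k < N)%N by rewrite -kN -addSnnS leq_addr.
have [r1 r2] := Ireg k s' (ltnW kN') Ik.
have [t1 [s1 [ex1 q1 tb1]]] := Istep k s' kN' Ik.
have [|t2 [s2 [ex2 q2 tb2]]] := IHm k.+1 _ _ q1; first by rewrite addSnnS.
exists ((t1 + 1) + t2).+1, s2; split=> //.
  apply: ExecWhileT ex2; first by rewrite /= r1 r2.
  exact: ExecSeq ex1 (ExecDo _ _ _).
by rewrite mulSn; lia.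
Qed.

End Runs.

(* Simplifying the register lookups after each instruction keeps the symbolic  *)
(* state from growing exponentially.                                           *)
Ltac exec_block :=
  repeat (apply: runs_cons; [by []|rewrite /= /upd /=]);
  apply: runs_do; [by []|rewrite /= /upd /=].

(** * Reading the inertia off the spectrum *)

Definition finish (p m : nat) : prog :=
  If (NLt p m) (Do (NSub 0 0 m)) (Do (NSub 0 0 p)).

Lemma runs_finish (R : realType) T p m (s : state R) :
  runs T (finish p m) s
    (fun s' => nreg s' 0 = nreg s 0 - maxn (nreg s p) (nreg s m))%N 2.
Proof.
apply: runs_if => /=.
by case: (ltnP (nreg s p) (nreg s m)) => h; apply: runs_do => //=.
Qed.

(** Natural registers 2 and 3 accumulate the multiplicities of positive and negative eigenvalues, 4
    is the index, 5 the current multiplicity and 6 the constant 1. [RZero 2] stands for doing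
    nothing. *)
Definition count_spectrum : prog :=
  Seq (Seq (Do (NConst 6 1))
    (for_loop 6 4 1
      (Seq (block (RLoad 1 4) [:: NLoad 5 4])
        (If (RLt 1 0) (Do (NAdd 3 3 5))
          (If (RLt 0 1) (Do (NAdd 2 2 5)) (Do (RZero 2)))))))
   (finish 2 3).

Lemma size_eigenvalues (R : realType) n (A : 'M[R]_n) : (size (eigenvalues A) <= n)%N.
Proof.
have nz : char_poly A != 0 by rewrite monic_neq0 ?char_poly_monic.
rewrite -ltnS -(size_char_poly A); apply: max_poly_roots => //; last first.
  by rewrite rev_uniq; apply: uniq_roots.
by apply/allP => x; rewrite mem_eigenvalues eigenvalue_root_char.
Qed.

Lemma runs_count_spectrum (R : realType) T n (A : 'M[R]_n) (s : state R)
    (th := eigenvalues A) :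
    nreg s 0 = n -> nreg s 1 = size th -> nreg s 2 = 0%N -> nreg s 3 = 0%N ->
    rreg s 0 = 0 ->
    (forall k, (k < size th)%N -> nmem s k = multiplicity A th`_k) ->
    (forall k, (k < size th)%N -> rmem s k = th`_k) ->
  runs T count_spectrum s
    (fun s' => nreg s' 0 =
       n - maxn (\sum_(x <- th | (0 < x)%R) multiplicity A x)
                (\sum_(x <- th | (x < 0)%R) multiplicity A x))%N
    (n * 7 + 5)%N.
Proof.
move=> s0 s1 s2 s3 r0 sm sr.
pose I k (s' : state R) := [/\ [/\ nreg s' 0 = n, nreg s' 1 = size th,
    nreg s' 4 = k & nreg s' 6 = 1%N], rreg s' 0 = 0, nmem s' = nmem s,
    rmem s' = rmem s &
   (nreg s' 2 = \sum_(x <- take k th | (0 < x)%R) multiplicity A x)%N /\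
   (nreg s' 3 = \sum_(x <- take k th | (x < 0)%R) multiplicity A x)%N].
(* A round costs two loads and at most two tests and an addition, and there are at most [n] distinct
   eigenvalues. *)
apply: (@runs_le _ _ (1 + (size th * (2 + 3).+2 + 2) + 2)%N); last first.
  by have := size_eigenvalues A; rewrite -/th; lia.
rewrite /count_spectrum; apply: (runs_seq (Q1 := I (size th))); last first.
  move=> s' [[e0 _ _ _] _ _ _ [e2 e3]].
  apply: runs_weaken (runs_finish _ _ _ _) _ _ => // s'' ->.
  by rewrite e0 e2 e3 take_size.
apply: (runs_seq (Q1 := fun s' => s' = step (NConst 6 1) s)).
  exact: runs_do.
move=> _ ->; apply: runs_for.
- by rewrite /I take0 !big_nil; split.
- by move=> k s' _ [[]].
move=> k s' kN [[e0 e1 e4 e6] f0 mE rE [e2 e3]].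
have tE : take k.+1 th = rcons (take k th) th`_k by apply: take_nth.
apply: (runs_seq (Q1 := fun s1 => s1 = step (NLoad 5 4) (step (RLoad 1 4) s'))).
  by exec_block.
move=> _ ->; apply: runs_if => /=.
rewrite /upd /= f0 e4 rE sr //.
case: (ltgtP th`_k 0) => h.
- apply: (@runs_le _ _ 1) => //; apply: runs_do => //=.
  rewrite /I /= /upd /= e0 e1 e2 e3 e4 e6 f0 mE sm // addn1 tE !big_rcons /= h.
  by rewrite (lt_gtF h) addn0; do !split.
- apply: runs_if => /=; rewrite /upd /= f0 h; apply: runs_do => //=.
  rewrite /I /= /upd /= e0 e1 e2 e3 e4 e6 f0 mE sm // addn1 tE !big_rcons /= h.
  by rewrite (lt_gtF h) addn0; do !split.
- apply: runs_if => /=; rewrite /upd /= f0 h ltxx; apply: runs_do => //=.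
  rewrite /I /= /upd /= e0 e1 e2 e3 e4 e6 f0 mE // addn1 tE !big_rcons /= h.
  by rewrite ltxx !addn0; do !split.
Qed.

(** * Computing the inertia by elimination *)

(* Natural registers: 0 holds n, 1 holds 1, 10 holds 0, 2 counts the rounds,    *)
(* 3 and 4 are loop indices, (5, 6) is the pivot pair, 7 and 8 count positive   *)
(* and negative pivots, 9 holds addresses. Real registers: 0 holds 0, 2 the     *)
(* pivot value. As there is no multiplication of naturals, the row offsets      *)
(* [k * n] are tabulated in natural memory for [k <= n]; row [n] of the real    *)
(* memory serves as scratch space. The [NConst 9 0] heading a block has no effect. *)
Definition fetch (r i j : nat) : seq instr := [:: NLoad 9 i; NAdd 9 9 j; RLoad r 9].

(** Register 9, initially 0, runs through the multiples of [n] by repeated addition. The last store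
    gives the address of the scratch row. *)
Definition tabulate_rows : prog :=
  Seq (Seq (Do (NConst 1 1))
           (for_loop 1 3 0 (block (NStore 3 9) [:: NAdd 9 9 0])))
      (Do (NStore 3 9)).

Definition pivot_value : seq instr :=
  fetch 1 3 3 ++ fetch 3 3 4 ++ RAdd 1 1 3 :: fetch 3 4 3 ++ RAdd 1 1 3 ::
  fetch 3 4 4 ++ [:: RAdd 1 1 3].

(** Adding a zero register serves as a move. *)
Definition record_pivot : prog := block (NAdd 5 3 10) [:: NAdd 6 4 10; RAdd 2 1 0].

(** There is no early exit: a later nonzero value overwrites an earlier one. A final value 0 signals
    that the matrix is zero. *)
Definition search_pivot : prog :=
  Seq (block (NConst 5 0) [:: NConst 6 0; RZero 2])
    (for_loop 1 3 0 (for_loop 1 4 0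
      (Seq (block (NConst 9 0) pivot_value)
           (If (RLt 1 0) record_pivot
              (If (RLt 0 1) record_pivot (Do (RZero 3))))))).

Definition count_pivot : prog :=
  If (RLt 2 0) (Do (NAdd 8 8 1)) (If (RLt 0 2) (Do (NAdd 7 7 1)) (Do (RZero 3))).

(** The row [v *m M] is saved in the scratch row first, so that the matrix can be overwritten in
    place. For a zero pivot value the division yields 0 and nothing changes. *)
Definition eliminate : prog :=
  Seq (for_loop 1 3 0
        (block (NConst 9 0) (fetch 3 5 3 ++ fetch 4 6 3 ++
          [:: RAdd 3 3 4; NLoad 9 0; NAdd 9 9 3; RStore 9 3])))
      (for_loop 1 3 0 (for_loop 1 4 0
        (block (NConst 9 0) (fetch 3 0 3 ++ fetch 4 0 4 ++
          RMul 3 3 4 :: RDiv 3 3 2 :: fetch 4 3 4 ++ [:: RSub 4 4 3; RStore 9 4])))).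

(** There are always [n] rounds; those after the matrix has become zero are idle. *)
Definition inertia_prog : prog :=
  Seq tabulate_rows
    (Seq (for_loop 1 2 0 (Seq (Seq search_pivot count_pivot) eliminate))
         (finish 7 8)).

(** * Correctness and cost of the elimination program *)

Section Elimination.
Variables (R : realType) (T : nat -> nat) (n : nat).
Implicit Types s : state R.

Definition ready s : Prop :=
  [/\ nreg s 0 = n, nreg s 1 = 1%N, nreg s 10 = 0%N, rreg s 0 = 0 &
      forall k, (k <= n)%N -> nmem s k = (k * n)%N].

Definition same_counters s s' : Prop :=
  [/\ nreg s' 2 = nreg s 2, nreg s' 7 = nreg s 7 & nreg s' 8 = nreg s 8].

Lemma runs_tabulate_rows s :
    nreg s 0 = n -> (forall k, k != 0%N -> nreg s k = 0%N) -> rreg s 0 = 0 ->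
  runs T tabulate_rows s (fun s' => [/\ ready s', rmem s' = rmem s,
    nreg s' 7 = 0%N & nreg s' 8 = 0%N]) (n * 4 + 4)%N.
Proof.
move=> s0 sz sr.
pose I k s' := [/\ [/\ nreg s' 0 = n, nreg s' 1 = 1%N, nreg s' 3 = k,
    nreg s' 10 = 0%N & nreg s' 9 = (k * n)%N], rreg s' 0 = 0, rmem s' = rmem s,
    nreg s' 7 = 0%N /\ nreg s' 8 = 0%N &
   forall j, (j < k)%N -> nmem s' j = (j * n)%N].
apply: (@runs_le _ _ (1 + (n * 4 + 2) + 1)%N); last by lia.
apply: (runs_seq (Q1 := I n)); last first.
  move=> s' [[e0 e1 e3 e10 e9] er em [e7 e8] en]; apply: runs_do => //=.
  split=> //; split=> //= k; rewrite /upd e3 e9.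
  by rewrite leq_eqVlt; case: eqP => [->|_] //=; apply: en.
apply: (runs_seq (Q1 := fun s' => s' = step (NConst 1 1) s)); first exact: runs_do.
move=> _ ->; apply: runs_for.
- by split=> //=; split; rewrite /= /upd /= ?mul0n ?s0 ?sz.
- by move=> k s' _ [[]].
move=> k s' kn [[e0 e1 e3 e10 e9] er em [e7 e8] en].
exec_block.
split; rewrite /= /upd /= ?e0 ?e1 ?e3 ?e9 ?e10 ?addn1 //.
  by split=> //; rewrite mulSn addnC.
move=> j; rewrite ltnS leq_eqVlt; case: eqP => [->|_] //=; exact: en.
Qed.

Definition pivot (f : nat -> R) (i j : nat) : R :=
  f (i * n + i)%N + f (i * n + j)%N + f (j * n + i)%N + f (j * n + j)%N.

Lemma runs_search_pivot s : (0 < n)%N -> ready s ->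
  runs T search_pivot s (fun s' => [/\ ready s', rmem s' = rmem s, same_counters s s',
    (nreg s' 5 < n)%N && (nreg s' 6 < n)%N &
    (rreg s' 2 = 0 /\ forall i j, (i < n)%N -> (j < n)%N -> pivot (rmem s) i j = 0) \/
    (rreg s' 2 != 0 /\ rreg s' 2 = pivot (rmem s) (nreg s' 5) (nreg s' 6))])
   (n * (n * 23 + 4) + 5)%N.
Proof.
move=> n0 rs.
(* Either every pair lexicographically before [(a, b)] has pivot value 0, or a nonzero one is
   recorded. *)
pose I a b s' := [/\ [/\ ready s', nmem s' = nmem s & rmem s' = rmem s],
   same_counters s s', (nreg s' 5 < n)%N && (nreg s' 6 < n)%N &
    (rreg s' 2 = 0 /\ forall i j, (i < n)%N -> (j < n)%N ->
       (i < a)%N || (i == a) && (j < b)%N -> pivot (rmem s) i j = 0) \/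
    (rreg s' 2 != 0 /\ rreg s' 2 = pivot (rmem s) (nreg s' 5) (nreg s' 6))].
apply: (@runs_le _ _ (3 + (n * (n * 21.+2 + 2).+2 + 2))%N); last by lia.
apply: (runs_seq (Q1 := I 0%N 0%N)).
  exec_block.
  case: rs => r0 r1 r10 rr rm.
  split; rewrite /= /upd /= ?n0 //; last by left; split=> // i j _ _; rewrite !ltn0 andbF.
move=> s1 I1.
pose K a s' := I a 0%N s' /\ nreg s' 3 = a.
apply: (@runs_post _ _ _ _ (K n)).
- apply: runs_for.
  + by case: I1 => -[[r0 r1 r10 rr rm] nE rE] [c2 c7 c8] f56 fr.
  + by move=> k s' _ [[[[]]]].
  move=> a s2 an [I2 e3].
  pose J b s' := [/\ I a b s', nreg s' 3 = a & nreg s' 4 = b].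
  apply: (@runs_post _ _ _ _ (J n)).
  + apply: runs_for.
    * by case: I2 => -[[r0 r1 r10 rr rm] nE rE] [c2 c7 c8] f56 fr.
    * by move=> k s' _ [[[[]]]].
    move=> b s3 bn [I3 e3' e4].
    (* The pivot value takes 16 steps (four fetches, three additions and the leading [NConst]); two
       tests and a recording take 5. *)
    apply: (@runs_le _ _ (16 + 5)%N) => //.
    apply: (runs_seq (Q1 := fun s' => J b s' /\ rreg s' 1 = pivot (rmem s) a b)).
      rewrite /pivot_value /=; exec_block.
      case: I3 => -[[r0 r1 r10 rr rm] nE rE] [c2 c7 c8] f56 fr.
      have [ma mb] := (rm a (ltnW an), rm b (ltnW bn)).
      rewrite /J /I /ready /same_counters /= /upd /= !(e3', e4, ma, mb) rE.
      by do !split.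
    move=> s4 [[I4 g3 g4] g1].
    case: I4 => -[[r0 r1 r10 rr rm] nE rE] [c2 c7 c8] f56 fr.
    have record : pivot (rmem s) a b != 0 ->
        runs T record_pivot s4 (fun s'' => J b.+1 (step (NAdd 4 4 1) s'')) 3.
      move=> nz; rewrite /record_pivot /=; exec_block.
      rewrite /J /I /ready /same_counters /= /upd /= g1 g3 g4 rr r1 r10.
      rewrite !addn0 addr0 addn1 an bn.
      by do !split=> //; right.
    apply: runs_if; rewrite /= g1 rr.
    case: (ltgtP (pivot (rmem s) a b) 0) => h.
    * by apply: (@runs_le _ _ 3) => //; apply: record; rewrite lt_eqF.
    * by apply: runs_if; rewrite /= g1 rr h; apply: record; rewrite gt_eqF.
    * apply: runs_if; rewrite /= g1 rr h ltxx; apply: (@runs_le _ _ 1) => //.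
      apply: runs_do => //=; rewrite /J /I /ready /same_counters /= /upd /= g3 g4 r1 addn1.
      do !split=> //; case: fr => [[q0 fr]|]; last by right.
      left; split=> // i j iN jN; rewrite ltnS [(j <= b)%N]leq_eqVlt.
      case: (eqVneq j b) => [->|_ /=]; last exact: fr.
      by case: (eqVneq i a) => [->|_ /=] //; rewrite ?orbF => ia; apply: fr => //; rewrite ia.
  + move=> s' [[[[r0 r1 r10 rr rm] nE rE] [c2 c7 c8] f56 fr] g3 g4].
    rewrite /K /I /ready /same_counters /= /upd /= g3 r1 addn1; do !split=> //.
    case: fr => [[q0 fr]|]; last by right.
    (* The frontier [(a, n)] is the same as [(a.+1, 0)]. *)
    left; split=> // i j iN jN; rewrite andbF orbF => ia; apply: fr => //.
    by rewrite jN andbT orbC -leq_eqVlt.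
- move=> s' [[[rd nE rE] cc f56 fr] g3]; split=> //.
  case: fr => [[q0 fr]|]; last by right.
  by left; split=> // i j iN jN; apply: fr; rewrite ?iN.
Qed.

Definition pivot_row (f : nat -> R) (i j k : nat) : R := f (i * n + k)%N + f (j * n + k)%N.

Lemma runs_eliminate s i j : ready s -> (i < n)%N -> (j < n)%N ->
    nreg s 5 = i -> nreg s 6 = j ->
  runs T eliminate s (fun s' => [/\ ready s', same_counters s s' &
    forall k l, (k < n)%N -> (l < n)%N -> rmem s' (k * n + l)%N =
      rmem s (k * n + l)%N
        - pivot_row (rmem s) i j k * pivot_row (rmem s) i j l / rreg s 2])
   (n * 13 + 2 + (n * (n * 16 + 4) + 2))%N.
Proof.
move=> rs iN jN e5 e6; set w := pivot_row _ i j; set q := rreg s 2.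
(* Only the columns are bounded, so this also separates the scratch row [n] from the matrix. *)
have addr_inj k l k' l' : (l < n)%N -> (l' < n)%N ->
    (k * n + l == k' * n + l')%N = (k == k') && (l == l').
  move=> lN lN'; apply/eqP/andP => [e|[/eqP-> /eqP->]//].
  have nN : (0 < n)%N by apply: leq_ltn_trans lN.
  have /(congr1 (divn^~ n)) := e; have /(congr1 (modn^~ n)) := e.
  rewrite /= !modnMDl !divnMDl // !modn_small // !divn_small // !addn0.
  by move=> -> ->.
pose F (g : nat -> R) s' := [/\ ready s', same_counters s s', rreg s' 2 = q &
   forall k l, (k < n)%N -> (l < n)%N -> rmem s' (k * n + l)%N = g (k * n + l)%N].
pose L a s' := [/\ F (rmem s) s', nreg s' 3 = a, nreg s' 5 = i, nreg s' 6 = j &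
   forall k, (k < a)%N -> rmem s' (n * n + k)%N = w k].
apply: (runs_seq (Q1 := L n)).
  apply: (@runs_le _ _ (n * 11.+2 + 2)%N) => //.
  apply: runs_for.
  - by case: rs => r0 r1 r10 rr rm.
  - by move=> k s' _ [[[]]].
  move=> a s1 an [[[r0 r1 r10 rr rm] [c2 c7 c8] qE mE] f3 f5 f6 wE].
  rewrite /=; exec_block.
  have [[mi mj] mn] := (rm i (ltnW iN), rm j (ltnW jN), rm n (leqnn n)).
  rewrite /L /F /ready /same_counters /= /upd /= !(f3, f5, f6, r0, r1, mi, mj, mn).
  rewrite !mE // addn1.
  do !split=> //=.
  - move=> k l kN lN; rewrite addr_inj // ltn_eqF //; exact: mE.
  - move=> k; rewrite ltnS leq_eqVlt eqn_add2l; case: eqP => [->|_] //=; exact: wE.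
move=> s1 [F1 _ _ _ wE1].
(* Entries in [treated] are already updated, the others still original; the scratch row keeps [w] as
   computed from the original matrix. *)
pose treated a b k l := (k < a)%N || (k == a) && (l < b)%N.
pose G a b s' := [/\ ready s', same_counters s s', rreg s' 2 = q,
   forall k, (k < n)%N -> rmem s' (n * n + k)%N = w k &
   forall k l, (k < n)%N -> (l < n)%N -> rmem s' (k * n + l)%N =
     if treated a b k l then rmem s (k * n + l)%N - w k * w l / q
     else rmem s (k * n + l)%N].
pose K a s' := G a 0%N s' /\ nreg s' 3 = a.
apply: (@runs_le _ _ (n * (n * 14.+2 + 2).+2 + 2)%N); last by lia.
apply: (@runs_post _ _ _ _ (K n)).
- apply: runs_for.
  + case: F1 => -[r0 r1 r10 rr rm] [c2 c7 c8] qE mE; split=> //; split=> //= k l kN lN.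
    by rewrite /treated ltn0 andbF mE.
  + by move=> k s' _ [[[]]].
  move=> a s2 an [G2 f3].
  pose J b s' := [/\ G a b s', nreg s' 3 = a & nreg s' 4 = b].
  apply: (@runs_post _ _ _ _ (J n)).
  + apply: runs_for.
    * by case: G2 => -[r0 r1 r10 rr rm] [c2 c7 c8] qE wE mE.
    * by move=> k s' _ [[[]]].
    move=> b s3 bn [[[r0 r1 r10 rr rm] [c2 c7 c8] qE wE mE] g3 g4].
    rewrite /=; exec_block.
    have [ma mn] := (rm a (ltnW an), rm n (leqnn n)).
    rewrite /J /G /ready /same_counters /= /upd /= !(g3, g4, r0, r1, qE, ma, mn).
    rewrite !wE // mE // addn1.
    do !split=> //=.
    * move=> k kN; rewrite addr_inj // gtn_eqF //=; exact: wE.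
    * move=> k l kN lN; rewrite addr_inj // mE // /treated ltnS [(l <= b)%N]leq_eqVlt.
      case: (eqVneq k a) => [->|_] //=; rewrite !ltnn andbF /=.
      by case: (eqVneq l b) => [->|_].
  + move=> s' [[[r0 r1 r10 rr rm] [c2 c7 c8] qE wE mE] g3 g4].
    rewrite /K /G /ready /same_counters /= /upd /= g3 r1 addn1.
    split=> //; split=> // k l kN lN.
    by rewrite mE // /treated lN andbF orbF andbT orbC -leq_eqVlt.
- move=> s' [[rd cc qE wE mE] _]; split=> // k l kN lN.
  by rewrite mE // /treated kN.
Qed.

Lemma runs_count_pivot s : ready s ->
  runs T count_pivot s (fun s' => [/\ ready s', rmem s' = rmem s,
    [/\ nreg s' 2 = nreg s 2, nreg s' 5 = nreg s 5 & nreg s' 6 = nreg s 6],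
    nreg s' 7 = (nreg s 7 + (0 < rreg s 2)%R)%N /\
    nreg s' 8 = (nreg s 8 + (rreg s 2 < 0)%R)%N & rreg s' 2 = rreg s 2]) 3.
Proof.
move=> [r0 r1 r10 rr rm].
apply: runs_if; rewrite /= rr; case: (ltgtP (rreg s 2) 0) => h.
- apply: (@runs_le _ _ 1) => //; apply: runs_do => //.
  by rewrite /ready /= /upd /= r1 addn0.
- apply: runs_if; rewrite /= rr h; apply: runs_do => //.
  by rewrite /ready /= /upd /= r1 addn0.
- apply: runs_if; rewrite /= rr h ltxx; apply: runs_do => //.
  by rewrite /ready /= /upd /= !addn0.
Qed.

Lemma pivot_qform s (i j : 'I_n) :
  pivot (rmem s) i j = qform (stored_matrix s n) (delta_mx 0 i + delta_mx 0 j).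
Proof. by rewrite qform_delta2 !mxE. Qed.

Lemma runs_inertia_prog (A P : 'M[R]_n) (d : 'rV[R]_n) :
    A^T = A -> P \in unitmx -> P *m A = diag_mx d *m P ->
  runs T inertia_prog (input A)
    (fun s' => nreg s' 0 =
       n - maxn #|[set i | (0 < d 0 i)%R]| #|[set i | (d 0 i < 0)%R]|)%N
    (n * (n * (n * 39 + 21) + 18) + 8)%N.
Proof.
move=> symA Pu PA.
(* Each of the [k] rounds so far counted an eigenvalue, unless the matrix is already zero. *)
pose I k s := [/\ ready s, nreg s 2 = k,
  inertia_split A (stored_matrix s n) (nreg s 7) (nreg s 8) &
  (k <= nreg s 7 + nreg s 8)%N \/ stored_matrix s n = 0].
apply: (@runs_le _ _ (n * 4 + 4 + (n * (n * (n * 23 + 4) + 5 + 3 +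
   (n * 13 + 2 + (n * (n * 16 + 4) + 2))).+2 + 2 + 2))%N); last by lia.
apply: (runs_seq (runs_tabulate_rows _ _ _)) => // [k k0|s1 [rd1 m1 s17 s18]].
  by rewrite /= /upd (negPf k0).
apply: (runs_seq (Q1 := I n)); last first.
  move=> s [[r0 _ _ _ _] _ sp stop].
  (* If [n] eigenvalues are counted, the rank inequality of [inertia_split] leaves rank 0 for the
     remainder. *)
  have M0 : stored_matrix s n = 0.
    case: stop => // ab; have [_ _ _ rk] := sp.
    apply/eqP; rewrite -mxrank_eq0 -leqn0 -(leq_add2r (nreg s 7 + nreg s 8)) add0n addnA.
    exact: leq_trans rk (leq_trans (rank_leq_row A) ab).
  rewrite M0 in sp; have [e7 e8] := inertia_split_end symA Pu PA sp.
  by apply: runs_post (runs_finish _ _ _ _) _ => s' ->; rewrite r0 e7 e8.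
apply: runs_for.
- case: rd1 => r0 r1 r10 rr rm; split=> //; last by left.
  rewrite /= /upd /= s17 s18.
  suff -> : stored_matrix (set_nreg s1 2 0) n = A by apply: inertia_split0.
  rewrite -[RHS]stored_input; apply/matrixP => i j.
  by rewrite !mxE /= m1.
- by move=> k s _ [[]].
move=> k s kn [rd e2 sp stop].
have n0 : (0 < n)%N by apply: leq_ltn_trans kn.
set M := stored_matrix s n in sp stop.
apply: (runs_seq (Q1 := fun s' => [/\ ready s', rmem s' = rmem s, nreg s' 2 = k,
    nreg s' 7 = (nreg s 7 + (0 < rreg s' 2)%R)%N /\
    nreg s' 8 = (nreg s 8 + (rreg s' 2 < 0)%R)%N &
    exists i j : 'I_n, [/\ nreg s' 5 = i, nreg s' 6 = j,
     rreg s' 2 = qform M (delta_mx 0 i + delta_mx 0 j)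
     & rreg s' 2 = 0 -> M = 0]])).
  apply: (runs_seq (runs_search_pivot n0 rd)) => s' [rd' m' [c2 c7 c8] /andP[i5 j6] piv].
  apply: runs_post (runs_count_pivot rd') _ => s'' [rd'' m'' [g2 g5 g6] [g7 g8] gr].
  split=> //; rewrite ?g2 ?g7 ?g8 ?c2 ?c7 ?c8 ?gr //; first by rewrite m'' m'.
  exists (Ordinal i5), (Ordinal j6); split=> //.
    by case: piv => [[-> z]|[_ ->]]; rewrite -pivot_qform //= z.
  case: piv => [[_ z] _|[/eqP nz _] z]; last by case: nz.
  have [symM _ _ _] := sp.
  by apply: sym_eq0 symM _ => i j; rewrite -pivot_qform z.
move=> s' [rd' m' e2' [e7 e8] [i [j [e5 e6 eq q0]]]].
have := runs_eliminate rd' (ltn_ord i) (ltn_ord j) e5 e6.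
move/runs_post; apply => s'' [[r0 r1 r10 rr rm] [c2 c7 c8] mE].
have ME : stored_matrix s'' n = elim_step M (delta_mx 0 i + delta_mx 0 j).
  apply/matrixP => a b.
  by rewrite elim_step_delta2 !mxE mE // m' eq /pivot_row.
have ME' : stored_matrix (step (NAdd 2 2 1) s'') n = stored_matrix s'' n by [].
rewrite /I ME' ME /= /upd /= r1 c2 c7 c8 e2' e7 e8 eq addn1.
have [z|nz] := eqVneq (qform M (delta_mx 0 i + delta_mx 0 j)) 0.
  have -> : elim_step M (delta_mx 0 i + delta_mx 0 j) = M.
    by rewrite /elim_step z invr0 scale0r subr0.
  have M0 : M = 0 by apply: q0; rewrite eq.
  by rewrite z ltxx !addn0; split=> //; right.
split=> //; first exact: inertia_split_step.
case: stop => [ab|M0]; last first.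
  by case/eqP: nz; rewrite M0 /qform mulmx0 mul0mx mxE.
left; move: nz; rewrite neq_lt; case: ltgtP => //= _ _; lia.
Qed.

End Elimination.

(** * Asymptotic bounds for the two programs *)

Lemma adjacency_sym (R : realType) n (G : sgraph n) :
  (adjacency R G)^T = adjacency R G.
Proof. by apply/matrixP => i j; rewrite !mxE edge_sym. Qed.

Local Close Scope ring_scope.

Theorem theorem4p5 (R : realType) :
  (exists Q : prog,
    let c := Seq (Do (Eig 0 1)) Q in
    [/\ eig_free Q,
        forall T : nat -> nat, bigO (fun n => n) T -> computes_mu1_in R T c T
      & forall T : nat -> nat, bigO T (fun n => n ^ 3) ->
          computes_mu1_in R T c (fun n => n ^ 3)])
  /\
  (exists P : prog, eig_free P /\
    forall T : nat -> nat, computes_mu1_in R T P (fun n => n ^ 3)).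
Proof.
have spectral T : computes_mu1 R T (Seq (Do (Eig 0 1)) count_spectrum)
    (fun n => T n + (n * 7 + 5))%N.
  move=> n G; have [d [P [Pu PA]]] := sym_diagonalizable (adjacency_sym R G).
  set s0 := input _.
  have A0 : stored_matrix s0 n = adjacency R G by apply: stored_input.
  have [|||||||t [s [ex mu tb]]] :=
      @runs_count_spectrum R T n (adjacency R G) (step (Eig 0 1) s0) => //.
  - by rewrite /= /upd /= A0.
  - by move=> k kN; rewrite /= /upd /= A0 kN.
  - by move=> k kN; rewrite /= /upd /= A0 kN.
  exists (T n + t)%N, s; split.
  - exact: (ExecSeq (ExecDo _ (Eig 0 1) _) ex).
  - rewrite mu !(sum_multiplicity _ Pu PA); exact: is_mu1_inertia Pu PA.
  - by rewrite leq_add2l.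
split.
  exists count_spectrum; split=> // T [C [N CN]].
  - exists (fun n => T n + (n * 7 + 5))%N => //.
    (* For [n >= 1] the scan costs at most [12 * n], and [n <= C * T n]. *)
    exists (1 + 12 * C)%N, (maxn N 1) => n; rewrite geq_max => /andP[nN n1].
    by have := CN n nN; lia.
  - exists (fun n => T n + (n * 7 + 5))%N => //.
    exists (C + 12)%N, (maxn N 1) => n; rewrite geq_max => /andP[nN n1].
    have := CN n nN; have : (n ^ 1 <= n ^ 3)%N by rewrite leq_pexp2l.
    by rewrite expn1; lia.
exists inertia_prog; split=> // T.
exists (fun n => n * (n * (n * 39 + 21) + 18) + 8)%N.
  (* The constant is the sum of the coefficients: 39 + 21 + 18 + 8. *)
  exists 86%N, 1%N => n n1.
  have : (n ^ 1 <= n ^ 3)%N by rewrite leq_pexp2l.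
  have : (n ^ 2 <= n ^ 3)%N by rewrite leq_pexp2l.
  rewrite expn1 !expnS expn0; lia.
move=> n G; have symA := adjacency_sym R G.
have [d [P [Pu PA]]] := sym_diagonalizable symA.
have [t [s [ex mu tb]]] := runs_inertia_prog T symA Pu PA.
by exists t, s; split=> //; rewrite mu; apply: is_mu1_inertia Pu PA.
Qed.
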